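(* Let $Y\in\mathbb R^{N\times C}$ have singular value decomposition $Y=U_y\Sigma_yV_y^T$, let $Z\in\mathbb R^{N\times K}$, and let $\widehat U_z$ (resp. $\widehat U_y$) be the matrix whose columns are the left singular vectors of $Z$ (resp. $Y$) associated to nonzero singular values. With $\mathcal L(W)=\frac12\|Y-ZW\|_F^2$, $$\min_{W\in\mathbb R^{K\times C}}\mathcal L(W)=\frac12\|Y\|_F^2-\frac12\|\widehat U_z^TU_y\Sigma_y\|_F^2,$$ which is $0$ if and only if the columns of $\widehat U_z$ span the columns of $\widehat U_y$.
   Context: In the SVD $Y=U_y\Sigma_yV_y^T$, $U_y\in\mathbb R^{N\times N}$ and $V_y\in\mathbb R^{C\times C}$ are orthogonal and $\Sigma_y\in\mathbb R^{N\times C}$ is (rectangular) diagonal with nonnegative entries. ''The columns of $\widehat U_z$ span the columns of $\widehat U_y$'' means that every column of $\widehat U_y$ lies in the linear span of the columns of $\widehat U_z$. *)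

(* Defs.v *)
From mathcomp Require Import all_boot all_order all_algebra.
From mathcomp Require Import reals.

Set Implicit Arguments.
Unset Strict Implicit.
Unset Printing Implicit Defensive.

Import Order.TTheory GRing.Theory Num.Theory.

Local Open Scope ring_scope.

Definition orthogonal_mx (R : realType) (n : nat) (U : 'M[R]_n) : Prop :=
  U^T *m U = 1%:M.

(* No ordering of the singular values is imposed. *)
Definition is_svd (R : realType) (m n : nat) (A : 'M[R]_(m, n))
    (U : 'M[R]_m) (S : 'M[R]_(m, n)) (V : 'M[R]_n) : Prop :=
  [/\ orthogonal_mx U, orthogonal_mx V,
      is_diag_mx S /\ (forall i j, 0 <= S i j)
    & A = U *m S *m V^T].

(* Indices i < min(m, n) with S_ii != 0; an equality of row and column indices
   is an equality in nat, since S may be rectangular. *)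
Definition nz_sv (R : realType) (m n : nat) (S : 'M[R]_(m, n)) : {set 'I_m} :=
  [set i : 'I_m | [exists j : 'I_n, (i == j :> nat) && (S i j != 0)]].

(* The columns of U at the indices of the nonzero singular values. *)
Definition hatU (R : realType) (m n : nat) (U : 'M[R]_m) (S : 'M[R]_(m, n)) :
    'M[R]_(m, #|nz_sv S|) :=
  colsub (fun k : 'I_#|nz_sv S| => enum_val k) U.

Definition frob (R : realType) (m n : nat) (A : 'M[R]_(m, n)) : R :=
  Num.sqrt (\sum_(i < m) \sum_(j < n) A i j ^+ 2).

Definition loss (R : realType) (N C K : nat) (Y : 'M[R]_(N, C))
    (Z : 'M[R]_(N, K)) (W : 'M[R]_(K, C)) : R :=
  2^-1 * frob (Y - Z *m W) ^+ 2.

(* The minimum is attained, not merely an infimum. *)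
Definition is_min_value (R : realType) (T : Type) (f : T -> R) (v : R) : Prop :=
  (exists w, f w = v) /\ (forall w, v <= f w).

(* [(_ <= _)%MS] compares row spaces, hence the transpositions. *)
Definition cols_span_cols (R : realType) (m p q : nat)
    (A : 'M[R]_(m, p)) (B : 'M[R]_(m, q)) : Prop :=
  forall j : 'I_q, ((col j B)^T <= A^T)%MS.

(* Main.v *)
(** The left singular vectors of [Z] with nonzero singular value form a matrix
    [H] with orthonormal columns and the same column space as [Z].  By
    Pythagoras, [|Y - H X|^2 = |Y|^2 - |H^T Y|^2 + |H^T Y - X|^2], so the
    minimum is reached at the orthogonal projection [H H^T Y]; it vanishes iff
    [Y = H H^T Y], that is, iff the column space of [Y], which is that of its
    own nonzero left singular vectors, lies in that of [H]. *)
Require Import Defs.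
From mathcomp Require Import all_boot all_order all_algebra.
From mathcomp Require Import reals.

Set Implicit Arguments.
Unset Strict Implicit.
Unset Printing Implicit Defensive.

Import Order.TTheory GRing.Theory Num.Theory.

Local Open Scope ring_scope.

Lemma frob_sqr_ge0 (R : realType) (m n : nat) (A : 'M[R]_(m, n)) :
  0 <= \sum_(i < m) \sum_(j < n) A i j ^+ 2.
Proof. by apply: sumr_ge0 => i _; apply: sumr_ge0 => j _; apply: sqr_ge0. Qed.

Lemma frob_sqr_mxtrace (R : realType) (m n : nat) (A : 'M[R]_(m, n)) :
  frob A ^+ 2 = \tr (A^T *m A).
Proof.
rewrite sqr_sqrtr ?frob_sqr_ge0 // exchange_big; apply: eq_bigr => j _.
by rewrite mxE; apply: eq_bigr => i _; rewrite mxE expr2.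
Qed.

Lemma frob_sqr_eq0 (R : realType) (m n : nat) (A : 'M[R]_(m, n)) :
  frob A ^+ 2 = 0 <-> A = 0.
Proof.
split=> [|->]; last by rewrite frob_sqr_mxtrace mulmx0 mxtrace0.
rewrite sqr_sqrtr ?frob_sqr_ge0 // => /eqP A0.
have row_ge0 i : 0 <= \sum_(j < n) A i j ^+ 2.
  by apply: sumr_ge0 => j _; apply: sqr_ge0.
apply/matrixP => i j; rewrite mxE; apply/eqP; rewrite -sqrf_eq0.
move: A0; rewrite psumr_eq0 // => /allP/(_ i (mem_index_enum _)) /=.
rewrite psumr_eq0 => [/allP/(_ j (mem_index_enum _)) //|k _].
exact: sqr_ge0.
Qed.

Lemma frob_sqr_mulmx_orthogonal (R : realType) (m n : nat) (A : 'M[R]_(m, n))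
    (V : 'M[R]_n) :
  orthogonal_mx V -> frob (A *m V) ^+ 2 = frob A ^+ 2.
Proof.
move=> /mulmx1C VVt; rewrite !frob_sqr_mxtrace trmx_mul -mulmxA mxtrace_mulC.
by rewrite -!mulmxA VVt mulmx1.
Qed.

(** Expand both sides as traces: [H^T *m H = 1%:M] turns the quadratic term of [H *m X] into that of
    [X], the cross terms agree, and the square of [H^T *m Y] cancels. *)
Lemma frob_sqr_residual (R : realType) (m n r : nat) (H : 'M[R]_(m, r))
    (Y : 'M[R]_(m, n)) (X : 'M[R]_(r, n)) :
  H^T *m H = 1%:M ->
  frob (Y - H *m X) ^+ 2 =
    frob Y ^+ 2 - frob (H^T *m Y) ^+ 2 + frob (H^T *m Y - X) ^+ 2.
Proof.
move=> HH; rewrite !frob_sqr_mxtrace !linearB /= !trmx_mul trmxK.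
rewrite !mulmxBl !linearB /= -!mulmxA [H^T *m (H *m X)]mulmxA HH mul1mx.
by rewrite !opprB !addrA subrK.
Qed.

Lemma hatU_orthonormal (R : realType) (m n : nat) (U : 'M[R]_m)
    (S : 'M[R]_(m, n)) :
  orthogonal_mx U -> (hatU U S)^T *m hatU U S = 1%:M.
Proof.
move=> /matrixP UU; apply/matrixP => i j.
have := UU (enum_val i) (enum_val j).
rewrite !mxE (inj_eq enum_val_inj) => <-.
by apply: eq_bigr => k _; rewrite !mxE.
Qed.

(** Transposing gives [V *m (S^T *m U^T)]. The invertible left factor [V] does not change the row
    space, and each row of [S^T *m U^T] is zero or a nonzero multiple of a row of [(hatU U S)^T]. *)
Lemma svd_colspace (R : realType) (m n : nat) (A : 'M[R]_(m, n))
    (U : 'M[R]_m) (S : 'M[R]_(m, n)) (V : 'M[R]_n) :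
  is_svd A U S V -> (A^T :=: (hatU U S)^T)%MS.
Proof.
case=> _ VV [/is_diag_mxP Sdiag _] ->.
have rowH k : row k (hatU U S)^T = row (enum_val k) U^T.
  by apply/rowP => j; rewrite !mxE.
have rowSU (i : 'I_m) (j : 'I_n) : i = j :> nat ->
    row j (S^T *m U^T) = S i j *: row i U^T.
  move=> ij; rewrite row_mul mulmx_sum_row (bigD1 i) //= big1 => [|k ki].
    by rewrite !mxE addr0.
  by rewrite !mxE Sdiag ?scale0r // -ij.
apply: (eqmx_trans (B := S^T *m U^T)).
  rewrite !trmx_mul trmxK; apply: eqmxMfull.
  by rewrite row_full_unit; case: (mulmx1_unit VV).
apply/eqmxP/andP; split; apply/row_subP => j.
  (* When [S] has more columns than rows, a column index beyond [m] misses the diagonal, so the row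
     vanishes. *)
  have [jm|mj] := ltnP j m; last first.
    rewrite row_mul mulmx_sum_row big1 ?sub0mx // => k _.
    by rewrite !mxE Sdiag ?scale0r // neq_ltn (leq_trans (ltn_ord k) mj).
  rewrite (rowSU (Ordinal jm)) //.
  have [->|Sj] := eqVneq (S (Ordinal jm) j) 0; first by rewrite scale0r sub0mx.
  have jnz : Ordinal jm \in nz_sv S.
    by rewrite inE; apply/existsP; exists j; rewrite /= eqxx.
  by rewrite scalemx_sub // -(enum_rankK_in jnz jnz) -rowH row_sub.
rewrite rowH; have := enum_valP j; rewrite inE => /existsP[k /andP[/eqP jk Sjk]].
(* Scaling by the nonzero singular value keeps the span and yields row [k] of [S^T *m U^T]. *)
by rewrite -(eqmx_scale _ Sjk) -rowSU // row_sub.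
Qed.

Lemma cols_span_colsE (R : realType) (m p q : nat)
    (A : 'M[R]_(m, p)) (B : 'M[R]_(m, q)) :
  cols_span_cols A B <-> (B^T <= A^T)%MS.
Proof.
split=> [AB|/row_subP AB j]; last by rewrite tr_col.
by apply/row_subP => j; rewrite -tr_col.
Qed.

(** If [Y] is [H] times some matrix, [H^T *m Y] recovers that matrix. *)
Lemma eq_projection_colspace (R : realType) (m n r : nat) (H : 'M[R]_(m, r))
    (Y : 'M[R]_(m, n)) :
  H^T *m H = 1%:M -> Y = H *m (H^T *m Y) <-> (Y^T <= H^T)%MS.
Proof.
move=> HH; split=> [->|/submxP[D /(congr1 trmx)]].
  by rewrite trmx_mul submxMl.
by rewrite trmx_mul !trmxK => ->; rewrite [H^T *m _]mulmxA HH mul1mx.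
Qed.

Theorem theorem8 (R : realType) (N C K : nat)
    (Y : 'M[R]_(N, C)) (Z : 'M[R]_(N, K))
    (Uy : 'M[R]_N) (Sy : 'M[R]_(N, C)) (Vy : 'M[R]_C)
    (Uz : 'M[R]_N) (Sz : 'M[R]_(N, K)) (Vz : 'M[R]_K)
    (svdY : is_svd Y Uy Sy Vy) (svdZ : is_svd Z Uz Sz Vz) :
  let v := 2^-1 * frob Y ^+ 2
           - 2^-1 * frob ((hatU Uz Sz)^T *m Uy *m Sy) ^+ 2 in
  is_min_value (loss Y Z) v
  /\ (v = 0 <-> cols_span_cols (hatU Uz Sz) (hatU Uy Sy)).
Proof.
have colY := svd_colspace svdY; have colZ := svd_colspace svdZ.
have HH : (hatU Uz Sz)^T *m hatU Uz Sz = 1%:M.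
  by apply: hatU_orthonormal; case: svdZ.
(* The two arguments differ by the orthogonal right factor [Vy^T], which preserves the norm. *)
have HY : frob ((hatU Uz Sz)^T *m Uy *m Sy) ^+ 2
          = frob ((hatU Uz Sz)^T *m Y) ^+ 2.
  case: svdY => _ VV _ ->.
  rewrite !mulmxA [RHS]frob_sqr_mulmx_orthogonal //.
  by rewrite /orthogonal_mx trmxK; apply: mulmx1C.
move: (hatU Uz Sz) HH HY colZ => H HH -> colZ v.
(* [B] rewrites every [Z *m W] as [H *m (B *m W)], for the lower bound; [M] below lifts the
   projection back to a minimizer [W]. *)
have [B ZE] : exists B, Z = H *m B.
  have /submxP[D /(congr1 trmx)] : (Z^T <= H^T)%MS by rewrite colZ.
  by rewrite trmx_mul !trmxK => ->; exists D^T.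
have [M HE] : exists M, H = Z *m M.
  have /submxP[D /(congr1 trmx)] : (H^T <= Z^T)%MS by rewrite colZ.
  by rewrite trmx_mul !trmxK => ->; exists D^T.
(* The choice [X = H^T *m Y] kills the last square of the Pythagorean identity. *)
have vE : v = 2^-1 * frob (Y - H *m (H^T *m Y)) ^+ 2.
  rewrite frob_sqr_residual // subrr.
  by rewrite ((frob_sqr_eq0 0).2 erefl) addr0 mulrBr.
split; first split.
- by exists (M *m (H^T *m Y)); rewrite /loss mulmxA -HE vE.
- move=> W; rewrite /loss ZE -mulmxA frob_sqr_residual // /v -mulrBr.
  by rewrite ler_pM2l ?invr_gt0 ?ltr0n // lerDl sqr_ge0.
rewrite cols_span_colsE -colY -eq_projection_colspace // vE.
split=> [/eqP|<-]; last first.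
  by rewrite subrr ((frob_sqr_eq0 0).2 erefl) mulr0.
rewrite mulf_eq0 invr_eq0 pnatr_eq0 /= => /eqP/frob_sqr_eq0/eqP.
by rewrite subr_eq0 => /eqP.
Qed.
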